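(* Let $\mathscr B$ be the class of Baire spaces (in the sense of category), and let $E\in\mathscr B\cap C_s(\mathscr B)$ be first countable, i.e. $E$ is a first countable Baire space which is a $C_s(\mathscr B)$-space. Then $E$ is regular.
   Context: All topological spaces are Hausdorff. $\overline{A}$ denotes closure and $A^\circ$ interior. A mapping $f:F\to E$ is nearly continuous if $f^{-1}(V)\subseteq \left(\overline{f^{-1}(V)}\right)^\circ$ for every open $V\subseteq E$. It is separating if for any $x,y\in E$ with $x\neq y$ there exist neighborhoods $V_x$ of $x$ and $V_y$ of $y$ in $E$ such that $\overline{f^{-1}(V_x)}\cap f^{-1}(V_y)=\emptyset=f^{-1}(V_x)\cap\overline{f^{-1}(V_y)}$. For a class $\mathscr K$ of Hausdorff spaces, a Hausdorff space $E$ is a $C_s(\mathscr K)$-space if for every $F\in\mathscr K$, every nearly continuous separating mapping $f:F\to E$ is continuous. $C_s(\mathscr B)$ also denotes the class of $C_s(\mathscr B)$-spaces. *)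

(* Defs.v *)
From HB Require Import structures.
From mathcomp Require Import all_boot.
From mathcomp Require Import boolp classical_sets functions cardinality.
From mathcomp Require Import topology.
Set Implicit Arguments.
Unset Strict Implicit.
Unset Printing Implicit Defensive.
Local Open Scope classical_set_scope.

Definition nearly_continuous (F E : topologicalType) (f : F -> E) : Prop :=
  forall V : set E, open V -> f @^-1` V `<=` (closure (f @^-1` V))°.

Definition separating (F E : topologicalType) (f : F -> E) : Prop :=
  forall x y : E, x <> y ->
  exists Vx Vy : set E,
    [/\ nbhs x Vx, nbhs y Vy,
        closure (f @^-1` Vx) `&` (f @^-1` Vy) = set0 &
        (f @^-1` Vx) `&` closure (f @^-1` Vy) = set0].

(* [K] is meant to be a class of Hausdorff spaces; [topologicalType] itself
   imposes no separation axiom. *)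
Definition Cs_space (K : topologicalType -> Prop) (E : topologicalType) : Prop :=
  hausdorff_space E /\
  forall F : topologicalType, K F ->
  forall f : F -> E, nearly_continuous f -> separating f -> continuous f.

Definition hausdorff_baire_space (T : topologicalType) : Prop :=
  hausdorff_space T /\
  forall U : nat -> set T, (forall n, open (U n) /\ dense (U n)) ->
  dense (\bigcap_n U n).

Definition first_countable (T : topologicalType) : Prop :=
  forall x : T, exists B : set (set T),
    [/\ countable B, B `<=` nbhs x &
        forall U : set T, nbhs x U -> exists2 V, B V & V `<=` U].

(* Main.v *)
Require Import Defs.
From HB Require Import structures.
From mathcomp Require Import all_boot.
From mathcomp Require Import boolp classical_sets functions cardinality.
From mathcomp Require Import topology.

(** The idea is to make the closures of the basic neighbourhoods of a point [x]
    of [E] open, and to check that this changes too little for the identity map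
    to stop being nearly continuous and separating.

    Let [U 0 = E, U 1, U 2, ...] be a decreasing base of open neighbourhoods of
    [x].  Let [F] be the set [E] in which the sets [closure (U n)] form a base
    at [x], while a point [y] other than [x] has as neighbourhoods the sets
    containing [y] and some [W `&` U n], where [W] is a neighbourhood of [y] in
    [E] and [y] lies in [closure (U n)].  Any such [W `&` U n] is nonempty, so
    the points of [closure (U n)] are still limits of [U n] in [F].  Away from
    [x] the topology of [F] is finer than that of [E]; at [x] it is coarser,
    strictly so when [E] is not regular at [x].

    The identity from [F] to [E] is nearly continuous: away from [x] it is even
    continuous, and at [x] the open set [closure (U n)] is contained in the
    closure of [U n] in [F] ([nearly_continuous_from_thickened]).  It is
    separating because, for [V] open in [E], the closure of [V] in [F] is
    contained in its closure in [E]: an open set that meets [closure (U n)]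
    meets [U n] ([thickened_closure_sub]).  These two facts also make [F]
    Hausdorff.  Finally [F] is Baire because, when [x] is not isolated, the
    nonempty open sets of either topology contain nonempty open sets of the
    other ([thickened_baire]).

    A C_s-space [E] therefore makes the identity continuous at [x], which says
    that each neighbourhood of [x] in [E] contains some [closure (U n)]. *)

Set Implicit Arguments.
Unset Strict Implicit.
Unset Printing Implicit Defensive.
Local Open Scope classical_set_scope.

(** * Decreasing bases at a point *)

Section DecreasingBase.
Variables (E : topologicalType) (x : E).

(** Requiring the first set to be the whole space lets every point belong to the
    closure of at least one member. *)
Record decreasing_base := DecreasingBase {
  base_set :> nat -> set E;
  base_set0 : base_set 0 = setT;
  base_open : forall n, open (base_set n);
  base_mem : forall n, base_set n x;
  base_decr : forall m n, (m <= n)%N -> base_set n `<=` base_set m;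
  base_sub : forall V, nbhs x V -> exists n, base_set n `<=` V
}.

Lemma first_countable_decreasing_base :
  first_countable E -> $|decreasing_base|.
Proof.
move=> /(_ x)[B [cB nB bB]].
have [B0|[e]] := pfcard_geP cB.
  by have [V] := bB _ filterT; rewrite B0.
pose V n : set E := \big[setI/setT]_(k < n) (e k)°.
have nbe k : nbhs x (e k) by apply/nB/(@funS _ _ _ _ e).
have decr m n : (m <= n)%N -> V n `<=` V m.
  elim: n => [|n IH]; first by rewrite leqn0 => /eqP->.
  rewrite leq_eqVlt => /predU1P[->//|/IH]; apply: subset_trans.
  by rewrite /V big_ord_recr /=; apply: subIsetl.
squash (@DecreasingBase V _ _ _ decr _).
- by rewrite /V big_ord0.
- move=> n; rewrite /V; elim/big_ind: _ => [|A C|k _]; first exact: openT.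
    exact: openI.
  exact: open_interior.
- move=> n; rewrite /V; elim/big_ind: _ => [//|A C Ax Cx|k _]; first by split.
  exact: nbe.
- move=> W /bB[C BC CW]; have [k _ ek] := @surj _ _ _ _ e C BC.
  exists k.+1; apply: subset_trans CW; rewrite -ek /V big_ord_recr /=.
  by move=> z [_ /interior_subset].
Qed.

End DecreasingBase.

(** * The topology in which closures of basic neighbourhoods are open *)

Definition thickened (E : topologicalType) (x : E) (U : decreasing_base x) : Type :=
  E.

Section Thickened.
Variables (E : topologicalType) (x : E) (U : decreasing_base x).

Local Notation F := (thickened U).

(** Away from [x] the set [U n] occurs so that [closure (U n)] becomes open: its
    points other than [x] then have a neighbourhood included in [U n], up to the
    point itself. *)
Definition thickened_open (V : set F) : Prop :=
  (V x -> exists n, closure (U n) `<=` V) /\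
  (forall y : E, y <> x -> V y ->
   exists n W, [/\ closure (U n) y, nbhs y W & W `&` U n `<=` V]).

Let thickened_openT : thickened_open setT.
Proof.
split=> [_|y _ _]; first by exists 0%N.
exists 0%N, setT; split=> //; first by rewrite base_set0 closureT.
exact: filterT.
Qed.

Let thickened_openI : setI_closed thickened_open.
Proof.
move=> A B [Ax Ay] [Bx By]; split=> [[/Ax[m mA] /Bx[n nB]]|y yx [Ay' By']].
  exists (maxn m n) => z Uz; split.
    by apply: mA; apply: closureS Uz; apply/base_decr/leq_maxl.
  by apply: nB; apply: closureS Uz; apply/base_decr/leq_maxr.
have [m [V [my yV mA]]] := Ay y yx Ay'; have [n [W [ny yW nB]]] := By y yx By'.
exists (maxn m n), (V `&` W); split.
- by rewrite /maxn; case: ifP.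
- exact: filterI.
- move=> z [[Vz Wz] Uz]; split.
    by apply: mA; split=> //; apply: base_decr Uz; apply: leq_maxl.
  by apply: nB; split=> //; apply: base_decr Uz; apply: leq_maxr.
Qed.

Let thickened_open_bigU (I : Type) (f : I -> set F) :
  (forall i, thickened_open (f i)) -> thickened_open (\bigcup_i f i).
Proof.
move=> fo; split=> [[i _ /(proj1 (fo i))[n nf]]|y yx [i _ fy]].
  by exists n => z /nf fz; exists i.
have [n [W [ny yW nf]]] := proj2 (fo i) y yx fy.
by exists n, W; split=> // z /nf fz; exists i.
Qed.

HB.instance Definition _ := Choice.copy F E.
HB.instance Definition _ := isOpenTopological.Build F
  thickened_openT thickened_openI thickened_open_bigU.

Definition from_thickened (z : F) : E := z.

Lemma thickened_openE : @open F = thickened_open.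
Proof. by []. Qed.

Lemma thickened_open_away (V : set E) : open V -> ~ V x -> open (V : set F).
Proof.
move=> oV Vx; rewrite thickened_openE; split=> // y yx Vy; exists 0%N, V.
split; [by rewrite base_set0 closureT| exact: open_nbhs_nbhs |exact: subIsetl].
Qed.

Lemma thickened_open_closure n : open (closure (U n) : set F).
Proof.
rewrite thickened_openE; split=> [_|y yx ny]; first by exists n.
exists n, setT; split=> //; first exact: filterT.
by move=> z [_]; apply: subset_closure.
Qed.

Lemma thickened_nbhs_closure n : nbhs (x : F) (closure (U n) : set F).
Proof.
apply: open_nbhs_nbhs; split; first exact: thickened_open_closure.
exact/subset_closure/base_mem.
Qed.

(** The index [k] at [p] and the index [n] are comparable, and [p] is in the
    closure of the smaller of [U k] and [U n], so every neighbourhood of [p]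
    meets [U n]. *)
Lemma closure_sub_thickened_closure n :
  closure (U n) `<=` closure (U n : set F).
Proof.
move=> p np N; rewrite nbhsE => -[O [oO Op] ON].
have [px|px] := pselect (p = x).
  by exists x; split; [exact: base_mem|apply: ON; rewrite -px].
move: oO; rewrite thickened_openE => -[_ /(_ p px Op)[k [W [kp pW WO]]]].
have /(_ W pW)[z [Uz Wz]] : closure (U (maxn k n)) p.
  by rewrite /maxn; case: ifP.
exists z; split; first by apply: base_decr Uz; apply: leq_maxr.
by apply/ON/WO; split=> //; apply: base_decr Uz; apply: leq_maxl.
Qed.

Hypothesis hE : hausdorff_space E.

Let closed_point : closed [set x].
Proof. exact/accessible_closed_set1/hausdorff_accessible. Qed.

Let open_remove_point (V : set E) : open V -> open (V `\ x).
Proof. by move=> oV; apply: openI => //; exact: closed_openC. Qed.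

Let thickened_open_remove_point (V : set E) : open V -> open (V `\ x : set F).
Proof.
move=> /open_remove_point oV; apply: thickened_open_away => //.
by move=> [_]; apply.
Qed.

Lemma nearly_continuous_from_thickened : nearly_continuous from_thickened.
Proof.
move=> V oV y Vy; have [yx|yx] := pselect ((y : E) = x); last first.
  rewrite /interior nbhsE; exists (V `\ x : set F).
    by split; [exact: thickened_open_remove_point|].
  by move=> z [Vz _]; exact: subset_closure.
have [n nV] : exists n, U n `<=` V.
  by apply: base_sub; apply: open_nbhs_nbhs; split=> //; rewrite -yx.
rewrite yx /interior.
apply: (@filterS F (nbhs (x : F)) _ _ _ _ (thickened_nbhs_closure n)).
by move=> z /closure_sub_thickened_closure; exact: (@closureS F).
Qed.

(** At [x] this holds because an open set meeting [closure (U n)] meets [U n];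
    elsewhere the new topology is finer. *)
Lemma thickened_closure_sub (V : set E) :
  open V -> closure (V : set F) `<=` closure V.
Proof.
move=> oV p Vp W pW; have [px|px] := pselect ((p : E) = x).
  have [n nW] : exists n, U n `<=` W by apply: base_sub; rewrite -px.
  have /Vp[z [Vz nz]] : nbhs p (closure (U n) : set F).
    by rewrite px; exact: thickened_nbhs_closure.
  have /nz[t [nt Vt]] : nbhs (z : E) V by apply: open_nbhs_nbhs.
  by exists t; split=> //; exact: nW.
have /Vp[z [Vz [Wz _]]] : nbhs p (W° `\ x : set F).
  apply: open_nbhs_nbhs; split=> //.
  exact/thickened_open_remove_point/open_interior.
by exists z; split=> //; exact: (@interior_subset E).
Qed.

Lemma thickened_closure_disjoint (A B : set E) :
  open A -> open B -> A `&` B = set0 -> closure (A : set F) `&` B = set0.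
Proof.
move=> oA oB AB0; rewrite -subset0 => z [/(thickened_closure_sub oA) Az Bz].
have /Az[t] : nbhs (z : E) B by apply: open_nbhs_nbhs.
by rewrite AB0.
Qed.

Let hausdorff_open (a b : E) : a <> b -> exists A B : set E,
  [/\ open A, open B, A a, B b & A `&` B = set0].
Proof.
move=> /eqP ab; move: hE; rewrite open_hausdorff => /(_ a b ab).
by move=> [[A B] /= [/set_mem Aa /set_mem Bb] [oA oB /eqP AB0]]; exists A, B.
Qed.

Lemma separating_from_thickened : separating from_thickened.
Proof.
move=> a b /hausdorff_open[A [B [oA oB Aa Bb AB0]]]; exists A, B; split.
- exact: open_nbhs_nbhs.
- exact: open_nbhs_nbhs.
- exact: thickened_closure_disjoint.
- by rewrite setIC; apply: thickened_closure_disjoint; rewrite // setIC.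
Qed.

(** One of two distinct points is not [x], hence keeps its open neighbourhoods
    that avoid [x]; near continuity provides a neighbourhood of the other. *)
Lemma thickened_hausdorff : hausdorff_space F.
Proof.
have sep (a b : F) : (b : E) <> x -> a <> b -> exists A B : set F,
    [/\ nbhs a A, nbhs b B & A `&` B = set0].
  move=> bx /hausdorff_open[A [B [oA oB Aa Bb AB0]]].
  exists (closure (A : set F)), (B `\ x); split.
  - exact: (nearly_continuous_from_thickened oA).
  - by apply: open_nbhs_nbhs; split; [exact: thickened_open_remove_point|].
  - rewrite -subset0 => z [Az [Bz _]].
    by rewrite -(thickened_closure_disjoint oA oB AB0).
move=> a b ab; apply: contrapT => nab.
have [bx|/sep/(_ nab)[A [B [aA bB AB0]]]] := pselect ((b : E) = x); last first.
  by have [z] := ab A B aA bB; rewrite AB0.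
have ax : (a : E) <> x by move=> ax; apply: nab; rewrite [a]ax [b]bx.
have [//|B [A [bB aA BA0]]] := sep b a ax; first by move=> ba; apply: nab.
by have [z] := ab A B aA bB; rewrite setIC BA0.
Qed.

(** Even at a point [y] outside every [U n] with [n > 0], the set [W `&` U n]
    has interior in [E], because [y] is a limit of the open set [U n]. *)
Lemma thickened_open_interior (V : set F) :
  open V -> V !=set0 -> (V : set E)° !=set0.
Proof.
rewrite thickened_openE => -[Vx Vy] [y yV].
have [yx|yx] := pselect ((y : E) = x).
  have [n nV] : exists n, closure (U n) `<=` V by apply: Vx; rewrite -yx.
  exists x; apply: filterS (subset_trans (@subset_closure _ (U n)) nV) _.
  by apply: open_nbhs_nbhs; split; [exact: base_open|exact: base_mem].
have [n [W [ny yW WV]]] := Vy y yx yV.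
have /ny[z [Uz Wz]] : nbhs (y : E) W° by apply: nbhs_interior.
exists z; apply: filterS WV _; apply: filterI => //.
by apply: open_nbhs_nbhs; split; [exact: base_open|].
Qed.

Hypothesis x_not_isolated : ~ open [set x].

(** A nonempty open set of [E] stays open in the new topology once [x] is removed,
    and remains nonempty because [x] is not isolated.  It therefore meets [D] in
    an open set of the new topology, which has interior in [E]. *)
Lemma thickened_dense_interior (D : set F) :
  open D -> dense D -> dense ((D : set E)°).
Proof.
move=> oD dD O O0 oO.
have [y yO] : (O `\ x : set F) !=set0.
  apply: contrapT => /set0P/negP/negPn/eqP Ox0; apply: x_not_isolated.
  suff -> : [set x] = O by [].
  have Ox : O `<=` [set x].
    by move=> z Oz; apply: contrapT => zx; have : (O `\ x) z by []; rewrite Ox0.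
  by apply/seteqP; split=> // _ ->; case: O0 => z /[dup] /Ox ->.
have oOx := thickened_open_remove_point oO.
have ODo : open (D `&` (O `\ x : set F)) by exact: openI.
have [|z] := thickened_open_interior ODo.
  by rewrite setIC; apply: dD => //; exists y.
rewrite interiorI => -[Dz /interior_subset[Oz _]].
by exists z.
Qed.

Lemma thickened_baire : hausdorff_baire_space E -> hausdorff_baire_space F.
Proof.
move=> [_ bE]; split=> [|D Dod G G0 oG]; first exact: thickened_hausdorff.
have [|||z [Gz Dz]] := bE (fun n => (D n : set E)°) _ (G : set E)°.
- move=> n; split; first exact: open_interior.
  by have [oD dD] := Dod n; exact: thickened_dense_interior.
- exact: thickened_open_interior.
- exact: open_interior.
exists z; split; first exact: interior_subset.
by move=> n _; apply: interior_subset; exact: Dz.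
Qed.

End Thickened.

(** * Regularity *)

Theorem corollary7 (E : topologicalType)
  (hE_baire : hausdorff_baire_space E)
  (hE_Cs : Cs_space hausdorff_baire_space E)
  (hE_fc : first_countable E) :
  regular_space E.
Proof.
have [hE Cs] := hE_Cs; move=> x V xV; rewrite /filter_from /=.
have closed_x : closed [set x].
  exact/accessible_closed_set1/hausdorff_accessible.
have [ox|nox] := pselect (open [set x]).
  (* An isolated point is its own closed neighbourhood. *)
  exists [set x]; first exact: open_nbhs_nbhs.
  rewrite -(closure_id _).1 // => _ ->; exact: nbhs_singleton.
have [U] := first_countable_decreasing_base x hE_fc.
have : continuous (@from_thickened _ _ U).
  apply: Cs; first exact: thickened_baire.
    exact: nearly_continuous_from_thickened.
  exact: separating_from_thickened.
move=> /(_ (x : thickened U) V xV); rewrite /= nbhs_simpl (@nbhsE (thickened U)).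
move=> [O [[oO _] Ox] OV]; have [n nO] := oO Ox.
exists (U n); last exact: subset_trans nO OV.
by apply: open_nbhs_nbhs; split; [exact: base_open|exact: base_mem].
Qed.
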